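(* Let $\mathscr{F}(r)=\int_0^1 t^{r-1/2}\sqrt{1+t}\,\arcsin t\,\mathrm{d}t$ for nonnegative integers $r$. For every integer $r\ge 3$, $$\sum_{n=1}^{\infty}\frac{1}{4^n n(n+3/2)}\frac{\binom{4n+2r}{2n+r}}{\binom{2n}{n}}=\frac{4}{9}\binom{2r}{r}+\frac{128}{3}\binom{2r-4}{r-2}-\frac{4^{r+1}}{3\pi}\mathscr{F}(r-1)-\frac{2\cdot 4^{r+1}}{3\pi}\mathscr{F}(r-3),$$ where, for every nonnegative integer $s$, $$\mathscr{F}(s)=\frac{(-1)^s}{4^s}\frac{\binom{2s}{s}}{s+1}\left(\mathscr{F}(0)+\frac{1}{2}\sum_{k=1}^s\frac{(-1)^k4^k}{\binom{2k}{k}}\,\omega_k\right),\qquad \omega_k=2\sqrt{2}\pi-2B(k+3/2,1/2)-2B(k+1/2,1/2).$$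
   Context: $B(u,v)=\int_0^1 t^{u-1}(1-t)^{v-1}\,\mathrm{d}t$ denotes the Beta function. *)

(* Defs.v *)
From Stdlib Require Import Reals.
From Coquelicot Require Import Coquelicot.
Open Scope R_scope.

Definition Beta (u v : R) : R :=
  RInt_gen (fun t => Rpower t (u - 1) * Rpower (1 - t) (v - 1))
           (at_right 0) (at_left 1).

Definition scrF (r : nat) : R :=
  RInt_gen (fun t => Rpower t (INR r - 1/2) * sqrt (1 + t) * asin t)
           (at_right 0) (at_left 1).

Definition omega (k : nat) : R :=
  2 * sqrt 2 * PI - 2 * Beta (INR k + 3/2) (1/2) - 2 * Beta (INR k + 1/2) (1/2).

(* general term of the series, n >= 1 *)
Definition term (r n : nat) : R :=
  / (4 ^ n * INR n * (INR n + 3/2)) * (Binomial.C (4*n + 2*r) (2*n + r) / Binomial.C (2*n) n).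

(* Main.v *)
Require Import Defs.
From Stdlib Require Import Reals Lra Lia Psatz.
From Coquelicot Require Import Coquelicot.
Open Scope R_scope.

(** With [W n = C(2n, n) / 4^n], Wallis' recursion telescopes to the exact finite identity
    [x = sum_(1 <= n <= N) sin^(2n-1) x cos x / (2 n W n) + P_N x] where
    [P_N' = sin^(2N) / W N].  Multiplying by [sin^3] and integrating from [0] gives
    [int_0^x t sin^3 t dt = (1/4) sum_(1 <= n <= N) sin^(2n+3) x / (n (n + 3/2) W n) + Q_N x]
    with [0 <= Q_N <= 1 / ((2N+1) W N) = O(1 / sqrt N)] on [[0, PI/2]].
    Put [x = asin (sin^2 phi)], multiply by [sin^(2r-6) phi] and integrate over
    [0 <= phi <= PI/2]: Wallis' integral turns the sum into the partial sum of the series,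
    the remainder vanishes uniformly, and the left side, whose inner integral is elementary,
    is a combination of Wallis integrals and of
    [scrF s = int_0^(PI/2) 2 sin^(2s) phi cos x x dphi] (substitute [t = sin^2 phi]).
    The closed form of [scrF] comes from the two-term recurrence obtained by integrating the
    derivative of [t^(s+1/2) (1+t)^(3/2) asin t] over [(0, 1)]. *)

(** * Normalised central binomial coefficients and their decay *)

Definition wallis (n : nat) : R := Binomial.C (2 * n) n / 4 ^ n.

Lemma wallis_0 : wallis 0 = 1.
Proof. unfold wallis, Binomial.C; simpl; field. Qed.

Lemma wallis_S (n : nat) :
  wallis (S n) = wallis n * ((2 * INR n + 1) / (2 * INR n + 2)).
Proof.
  unfold wallis, Binomial.C.
  replace (2 * S n - S n)%nat with (S n) by lia.
  replace (2 * n - n)%nat with n by lia.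
  replace (2 * S n)%nat with (S (S (2 * n))) by lia.
  rewrite !fact_simpl, !mult_INR, !S_INR, mult_INR; simpl (INR 2); simpl (4 ^ S n).
  pose proof (INR_fact_neq_0 n); pose proof (pos_INR n).
  assert (4 ^ n <> 0) by (apply pow_nonzero; lra).
  field; repeat split; try assumption; lra.
Qed.

Lemma wallis_pos (n : nat) : 0 < wallis n.
Proof.
  induction n as [|n IH]; [rewrite wallis_0; lra|].
  rewrite wallis_S; pose proof (pos_INR n).
  apply Rmult_lt_0_compat; [assumption|]. apply Rdiv_lt_0_compat; lra.
Qed.

(** With [W n = wallis n], the sequence [4 n (W n)^2] equals 1 at [n = 1] and grows by
    [(W n)^2 / (n + 1)] at each step. *)
Lemma wallis_sqr_lower (n : nat) : 1 <= 4 * INR (S n) * (wallis (S n)) ^ 2.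
Proof.
  induction n as [|n IH].
  - rewrite wallis_S, wallis_0; simpl; lra.
  - rewrite wallis_S.
    pose proof (wallis_pos (S n)); rewrite (S_INR (S n)).
    set (w := wallis (S n)) in *; set (x := INR (S n)) in *.
    assert (1 <= x) by (unfold x; rewrite S_INR; pose proof (pos_INR n); lra).
    apply Rle_trans with (1 := IH).
    replace (4 * (x + 1) * (w * ((2 * x + 1) / (2 * x + 2))) ^ 2)
      with (4 * x * w ^ 2 + w ^ 2 / (x + 1)) by (field; lra).
    assert (0 <= w ^ 2 / (x + 1)); [|lra].
    apply Rle_mult_inv_pos; [apply pow2_ge_0|lra].
Qed.

(** The previous bound says [2 sqrt n W n >= 1]; multiplying by [sqrt n] gives
    [2 n W n >= sqrt n]. *)
Lemma wallis_tail_bound (n : nat) :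
  / ((2 * INR (S n) + 1) * wallis (S n)) <= / sqrt (INR (S n)).
Proof.
  pose proof (wallis_sqr_lower n) as Hw; pose proof (wallis_pos (S n)).
  set (w := wallis (S n)) in *; set (x := INR (S n)) in *.
  assert (1 <= x) by (unfold x; rewrite S_INR; pose proof (pos_INR n); lra).
  pose proof (sqrt_lt_R0 x ltac:(lra)); pose proof (sqrt_sqrt x ltac:(lra)) as Hs.
  set (s := sqrt x) in *.
  apply Rinv_le_contravar; [assumption|].
  assert (1 <= 2 * s * w); [|nra].
  assert (1 <= (2 * s * w) ^ 2) by
    (replace ((2 * s * w) ^ 2) with (4 * (s * s) * w ^ 2) by ring; rewrite Hs; assumption).
  assert (0 < 2 * s * w) by (apply Rmult_lt_0_compat; lra).
  nra.
Qed.

(** * The finite expansion, its integral against [sin^3], and bounds on the remainders *)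

(* The remainder [P_N] of the header. *)
Fixpoint arc_rem (N : nat) (x : R) : R :=
  match N with
  | O => x
  | S m => arc_rem m x - sin x ^ (2 * m + 1) * cos x / (2 * INR (S m) * wallis (S m))
  end.

(* [int_0^x t sin^3 t dt], evaluated. *)
Definition arc_sin3_prim (x : R) : R :=
  - x * cos x * (2 + sin x ^ 2) / 3 + (2 * sin x + sin x ^ 3 / 3) / 3.

(** The factor of [term r n] that does not depend on [r]. *)
Definition term_coef (n : nat) : R := / (INR n * (INR n + 3 / 2) * wallis n).

(* The remainder [Q_N] of the header. *)
Fixpoint sin3_rem (N : nat) (x : R) : R :=
  match N with
  | O => arc_sin3_prim x
  | S m => sin3_rem m x - term_coef (S m) * sin x ^ (2 * m + 5) / 4
  end.

Lemma cos_sqr (x : R) : cos x ^ 2 = 1 - sin x ^ 2.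
Proof. pose proof (sin2_cos2 x) as H; unfold Rsqr in H; simpl; lra. Qed.

(** The derivative of [sin^(2m+1) cos] is [(2m+1) sin^(2m) - (2m+2) sin^(2m+2)]. Since
    [2 (m+1) W (m+1) = (2m+1) W m], the [sin^(2m)] terms cancel. *)
Lemma is_derive_arc_rem (N : nat) (x : R) :
  is_derive (arc_rem N) x (sin x ^ (2 * N) / wallis N).
Proof.
  induction N as [|m IH].
  - simpl. rewrite wallis_0. replace (1 / 1) with 1 by field. apply (is_derive_id x).
  - cbn [arc_rem].
    replace (sin x ^ (2 * S m) / wallis (S m)) with
      (sin x ^ (2 * m) / wallis m
       - ((2 * INR m + 1) * sin x ^ (2 * m) * cos x * cos x - sin x ^ (2 * m + 1) * sin x)
         / (2 * INR (S m) * wallis (S m))).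
    + apply (is_derive_minus (arc_rem m)); [exact IH|].
      pose proof (wallis_pos (S m)).
      assert (INR (S m) <> 0) by (rewrite S_INR; pose proof (pos_INR m); lra).
      remember (2 * m + 1)%nat as k eqn:Hk; set (y := INR (S m)) in *.
      auto_derive; [trivial|].
      replace (Nat.pred k) with (2 * m)%nat by lia.
      rewrite Hk, plus_INR, mult_INR; simpl (INR 1); simpl (INR 2).
      field; lra.
    + replace (2 * S m)%nat with (2 * m + 2)%nat by lia.
      rewrite !pow_add.
      replace ((2 * INR m + 1) * sin x ^ (2 * m) * cos x * cos x)
        with ((2 * INR m + 1) * sin x ^ (2 * m) * cos x ^ 2) by ring.
      rewrite cos_sqr, wallis_S, S_INR.
      pose proof (wallis_pos m); pose proof (pos_INR m).
      simpl (sin x ^ 1); field; lra.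
Qed.

(** With [n = m + 1], differentiating [sin^(2n+3)] produces [2 (n + 3/2)], which cancels against
    [term_coef n] and leaves [sin^3] times the summand of [arc_rem]. *)
Lemma is_derive_sin3_rem (N : nat) (x : R) :
  is_derive (sin3_rem N) x (sin x ^ 3 * arc_rem N x).
Proof.
  induction N as [|m IH].
  - cbn [sin3_rem]; unfold arc_sin3_prim; cbn [arc_rem].
    auto_derive; [trivial|].
    assert (H := cos_sqr x).
    transitivity (x * sin x * (2 + sin x ^ 2 - 2 * cos x ^ 2) / 3); [simpl; field|].
    rewrite H; simpl; field.
  - cbn [sin3_rem]; cbn [arc_rem].
    rewrite Rmult_minus_distr_l.
    apply (is_derive_minus (sin3_rem m)); [exact IH|].
    unfold term_coef.
    pose proof (wallis_pos (S m)).
    assert (Hm : INR (S m) = INR m + 1) by apply S_INR.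
    pose proof (pos_INR m).
    remember (2 * m + 5)%nat as k eqn:Hk; set (y := INR (S m)) in *.
    auto_derive; [trivial|].
    replace (Nat.pred k) with (3 + (2 * m + 1))%nat by lia.
    rewrite Hk, (pow_add _ 3), plus_INR, mult_INR; simpl (INR 5); simpl (INR 2).
    rewrite Hm; field; lra.
Qed.

Lemma nonneg_of_derive_nonneg (f f' : R -> R) (b : R) :
  0 <= b -> f 0 = 0 ->
  (forall x, 0 <= x <= b -> is_derive f x (f' x)) ->
  (forall x, 0 <= x <= b -> 0 <= f' x) -> 0 <= f b.
Proof.
  intros Hb H0 Hd Hp.
  destruct (MVT_gen f 0 b f') as [c [Hc Heq]].
  - intros x Hx; rewrite Rmin_left, Rmax_right in Hx by assumption; apply Hd; lra.
  - intros x Hx; rewrite Rmin_left, Rmax_right in Hx by assumption.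
    apply continuity_pt_filterlim, (ex_derive_continuous f).
    exists (f' x); apply Hd, Hx.
  - rewrite Rmin_left, Rmax_right in Hc by assumption.
    specialize (Hp c Hc); nra.
Qed.

Lemma sin_nonneg_quarter (x : R) : 0 <= x <= PI / 2 -> 0 <= sin x.
Proof. intros Hx; apply sin_ge_0; pose proof PI_RGT_0; lra. Qed.

Lemma cos_nonneg_quarter (x : R) : 0 <= x <= PI / 2 -> 0 <= cos x.
Proof. intros Hx; apply cos_ge_0; pose proof PI_RGT_0; lra. Qed.

Lemma arc_rem_0 (N : nat) : arc_rem N 0 = 0.
Proof.
  induction N as [|m IH]; [reflexivity|]; cbn [arc_rem].
  rewrite IH, sin_0, pow_i by lia; unfold Rdiv; ring.
Qed.

Lemma sin3_rem_0 (N : nat) : sin3_rem N 0 = 0.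
Proof.
  induction N as [|m IH]; cbn [sin3_rem].
  - unfold arc_sin3_prim; rewrite sin_0; field.
  - rewrite IH, sin_0, pow_i by lia; field.
Qed.

Lemma arc_rem_nonneg (N : nat) (x : R) : 0 <= x <= PI / 2 -> 0 <= arc_rem N x.
Proof.
  intros Hx.
  apply (nonneg_of_derive_nonneg _ (fun y => sin y ^ (2 * N) / wallis N));
    [lra|apply arc_rem_0| |]; intros y Hy; [apply is_derive_arc_rem|].
  apply Rle_mult_inv_pos; [|apply wallis_pos].
  apply pow_le, sin_nonneg_quarter; lra.
Qed.

Lemma sin3_rem_nonneg (N : nat) (x : R) : 0 <= x <= PI / 2 -> 0 <= sin3_rem N x.
Proof.
  intros Hx.
  apply (nonneg_of_derive_nonneg _ (fun y => sin y ^ 3 * arc_rem N y));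
    [lra|apply sin3_rem_0| |]; intros y Hy; [apply is_derive_sin3_rem|].
  apply Rmult_le_pos; [apply pow_le, sin_nonneg_quarter|apply arc_rem_nonneg]; lra.
Qed.

(** With [c] the right-hand side, [c sin^(2N+1) - cos P_N - Q_N] vanishes at 0 and has derivative
    [sin P_N cos^2 >= 0]. Hence [Q_N <= c sin^(2N+1) - cos P_N <= c]. *)
Lemma sin3_rem_upper (N : nat) (x : R) :
  0 <= x <= PI / 2 -> sin3_rem N x <= / ((2 * INR N + 1) * wallis N).
Proof.
  intros Hx.
  pose proof (wallis_pos N) as Hw; pose proof (pos_INR N) as HN.
  set (c := / ((2 * INR N + 1) * wallis N)).
  assert (Hc : 0 <= c) by (left; apply Rinv_0_lt_compat, Rmult_lt_0_compat; lra).
  assert (0 <= c * sin x ^ (2 * N + 1) - cos x * arc_rem N x - sin3_rem N x).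
  { apply (nonneg_of_derive_nonneg
      (fun y => c * sin y ^ (2 * N + 1) - cos y * arc_rem N y - sin3_rem N y)
      (fun y => sin y * arc_rem N y * cos y ^ 2)); [lra| | |].
    - rewrite arc_rem_0, sin3_rem_0, sin_0, pow_i by lia; ring.
    - intros y _.
      pose proof (is_derive_arc_rem N y) as H1; pose proof (is_derive_sin3_rem N y) as H2.
      remember (2 * N + 1)%nat as k eqn:Hk.
      auto_derive.
      + repeat split; eexists; eassumption.
      + apply is_derive_unique in H1; apply is_derive_unique in H2.
        replace (Derive (fun z : R => arc_rem N z) y)
          with (sin y ^ (2 * N) / wallis N) by (symmetry; exact H1).
        replace (Derive (fun z : R => sin3_rem N z) y)
          with (sin y ^ 3 * arc_rem N y) by (symmetry; exact H2).
        replace (Nat.pred k) with (2 * N)%nat by lia.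
        rewrite Hk, plus_INR, mult_INR, cos_sqr; simpl (INR 1); simpl (INR 2).
        unfold c; field; lra.
    - intros y Hy; apply Rmult_le_pos; [|apply pow2_ge_0].
      apply Rmult_le_pos; [apply sin_nonneg_quarter|apply arc_rem_nonneg]; lra. }
  assert (0 <= cos x * arc_rem N x)
    by (apply Rmult_le_pos; [apply cos_nonneg_quarter|apply arc_rem_nonneg]; lra).
  assert (sin x ^ (2 * N + 1) <= 1).
  { rewrite <- (pow1 (2 * N + 1)); apply pow_incr; split;
      [apply sin_nonneg_quarter; lra|apply SIN_bound]. }
  nra.
Qed.

(** * The arcsine up to the endpoint 1 *)

Lemma asin_nonneg (x : R) : 0 <= x <= 1 -> 0 <= asin x.
Proof.
  intros Hx; destruct (Rle_lt_dec 0 (asin x)) as [H|H]; [assumption|].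
  pose proof (asin_bound x); pose proof PI_RGT_0.
  pose proof (sin_lt_0_var (asin x)); rewrite sin_asin in *; lra.
Qed.

(* [asin] is not differentiable at [1]; this form makes its continuity there visible. *)
Lemma asin_half_angle (x : R) :
  0 <= x <= 1 -> asin x = 2 * atan (x / (1 + sqrt (1 - x ^ 2))).
Proof.
  intros Hx.
  pose proof (asin_nonneg x Hx) as H0; pose proof (asin_bound x) as H1; pose proof PI_RGT_0.
  set (y := asin x / 2).
  assert (Hc : 0 < cos y) by (apply cos_gt_0; unfold y; lra).
  assert (Hcos : sqrt (1 - x ^ 2) = 2 * cos y * cos y - 1).
  { rewrite <- cos_2a_cos; replace (2 * y) with (asin x) by (unfold y; field).
    rewrite cos_asin by lra; f_equal; unfold Rsqr; ring. }
  assert (Hsin : x = 2 * sin y * cos y).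
  { rewrite <- sin_2a; replace (2 * y) with (asin x) by (unfold y; field).
    symmetry; apply sin_asin; lra. }
  rewrite Hcos.
  replace (1 + (2 * cos y * cos y - 1)) with (2 * cos y * cos y) by ring.
  assert (Htan : tan y = x / (2 * cos y * cos y)).
  { transitivity (2 * sin y * cos y / (2 * cos y * cos y)).
    - unfold tan; field; apply Rgt_not_eq, Hc.
    - rewrite <- Hsin; reflexivity. }
  rewrite <- Htan.
  rewrite atan_tan; unfold y; [field|lra].
Qed.

(** Continuity of [asin] from within [[0, 1]], including both endpoints. The filter is arbitrary so
    that one-sided limits and ordinary continuity are both covered; the values must stay in
    [[0, 1]], where the half-angle formula holds. *)
Lemma filterlim_asin_comp {T : Type} (F : (T -> Prop) -> Prop) {FF : Filter F}
    (f : T -> R) (l : R) :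
  0 <= l <= 1 -> F (fun x => 0 <= f x <= 1) -> filterlim f F (locally l) ->
  filterlim (fun x => asin (f x)) F (locally (asin l)).
Proof.
  intros Hl Hf Hlim.
  apply (filterlim_ext_loc (fun x => 2 * atan (f x / (1 + sqrt (1 - f x ^ 2))))).
  - revert Hf; apply filter_imp; intros x Hx; symmetry; apply asin_half_angle, Hx.
  - rewrite (asin_half_angle l Hl).
    apply (filterlim_comp _ _ _ f (fun y => 2 * atan (y / (1 + sqrt (1 - y ^ 2)))) _ (locally l));
      [exact Hlim|].
    pose proof (sqrt_pos (1 - l ^ 2)).
    apply (continuous_mult (fun _ : R => 2) (fun y => atan (y / (1 + sqrt (1 - y ^ 2)))) l);
      [apply continuous_const|].
    apply continuous_atan_comp.
    apply (continuous_mult (fun y : R => y) (fun y => / (1 + sqrt (1 - y ^ 2)))).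
    + apply continuous_id.
    + apply continuous_Rinv_comp; [|lra].
      apply (continuous_plus (fun _ : R => 1) (fun y => sqrt (1 - y ^ 2)) l);
        [apply continuous_const|].
      apply continuous_sqrt_comp.
      apply (ex_derive_continuous (fun y => 1 - y ^ 2)); auto_derive; trivial.
Qed.

Lemma is_derive_asin (x : R) : -1 < x < 1 -> is_derive asin x (/ sqrt (1 - x ^ 2)).
Proof.
  intros Hx; apply is_derive_Reals.
  replace (/ sqrt (1 - x ^ 2)) with (derive_pt asin x (derivable_pt_asin x Hx)).
  - apply derive_pt_eq_1 with (derivable_pt_asin x Hx); reflexivity.
  - rewrite derive_pt_asin; unfold Rsqr; simpl; rewrite Rmult_1_r; field.
    apply Rgt_not_eq, sqrt_lt_R0; nra.
Qed.

(** * Improper integrals over [(0, 1)] and the substitution [t = sin^2 x] *)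

(** Separating the endpoints by [1/2] ensures [a < b], so [Rmin] and [Rmax] of the endpoints can be
    resolved. *)
Lemma filter_prod_unit_interval (P : R * R -> Prop) :
  (forall a b, 0 < a < 1 / 2 -> 1 / 2 < b < 1 -> P (a, b)) ->
  filter_prod (at_right 0) (at_left 1) P.
Proof.
  intros HP.
  apply (Filter_prod _ _ _ (fun a => 0 < a < 1 / 2) (fun b => 1 / 2 < b < 1)).
  - exists (mkposreal (1 / 2) ltac:(lra)); intros y Hy Hy0.
    apply Rabs_lt_between in Hy; unfold minus, plus, opp in Hy; simpl in Hy; lra.
  - exists (mkposreal (1 / 2) ltac:(lra)); intros y Hy Hy0.
    apply Rabs_lt_between in Hy; unfold minus, plus, opp in Hy; simpl in Hy; lra.
  - exact HP.
Qed.

Lemma at_right_0_lt_1 : at_right 0 (fun x => 0 < x < 1).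
Proof.
  exists (mkposreal 1 ltac:(lra)); intros y Hy Hy0.
  apply Rabs_lt_between in Hy; unfold minus, plus, opp in Hy; simpl in Hy; lra.
Qed.

Lemma at_left_1_gt_0 : at_left 1 (fun x => 0 < x < 1).
Proof.
  exists (mkposreal 1 ltac:(lra)); intros y Hy Hy0.
  apply Rabs_lt_between in Hy; unfold minus, plus, opp in Hy; simpl in Hy; lra.
Qed.

Lemma is_RInt_gen_unit_ext (f g : R -> R) (l : R) :
  (forall t, 0 < t < 1 -> f t = g t) ->
  is_RInt_gen f (at_right 0) (at_left 1) l -> is_RInt_gen g (at_right 0) (at_left 1) l.
Proof.
  intros Hfg; apply is_RInt_gen_ext.
  apply filter_prod_unit_interval; intros a b Ha Hb x; simpl.
  rewrite Rmin_left, Rmax_right by lra; intros Hx; apply Hfg; lra.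
Qed.

Lemma is_RInt_gen_unit_antiderivative (F f : R -> R) (l0 l1 : R) :
  (forall t, 0 < t < 1 -> is_derive F t (f t)) ->
  (forall t, 0 < t < 1 -> continuous f t) ->
  filterlim F (at_right 0) (locally l0) -> filterlim F (at_left 1) (locally l1) ->
  is_RInt_gen f (at_right 0) (at_left 1) (l1 - l0).
Proof.
  intros Hd Hc H0 H1.
  apply (is_RInt_gen_unit_ext (Derive F)).
  { intros t Ht; apply is_derive_unique, Hd, Ht. }
  apply is_RInt_gen_Derive; [| |exact H0|exact H1];
    apply filter_prod_unit_interval; intros a b Ha Hb x; simpl;
    rewrite Rmin_left, Rmax_right by lra; intros Hx.
  - exists (f x); apply Hd; lra.
  - apply (continuous_ext_loc (Derive F) f); [|apply Hc; lra].
    apply (filter_imp (fun t => 0 < t < 1)).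
    + intros t Ht; symmetry; apply is_derive_unique, Hd, Ht.
    + apply (open_and _ _ (open_gt 0) (open_lt 1)); lra.
Qed.

(** If [H] is the primitive of [h] from 0, then [H (asin (sqrt t))] is an antiderivative of [f] on
    [(0, 1)] by the chain rule. It has limits at both ends because [H] is continuous everywhere, so
    convergence and value come together. *)
Lemma is_RInt_gen_sin_sqr (f h : R -> R) :
  (forall t, 0 < t < 1 -> continuous f t) ->
  (forall x, continuous h x) ->
  (forall x, 0 < x < PI / 2 -> h x = f (sin x ^ 2) * (2 * sin x * cos x)) ->
  is_RInt_gen f (at_right 0) (at_left 1) (RInt h 0 (PI / 2)).
Proof.
  intros Hf Hh Heq.
  pose (H := fun x => RInt h 0 x).
  assert (HH : forall x, is_derive H x (h x)).
  { intros x; apply (is_derive_RInt h H 0 x); [|apply Hh].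
    apply filter_forall; intros b; apply (RInt_correct (V := R_CompleteNormedModule)).
    apply ex_RInt_continuous; intros; apply Hh. }
  assert (HC : forall x, continuous H x)
    by (intros x; apply (ex_derive_continuous H); exists (h x); apply HH).
  assert (Hs : forall t, 0 < t < 1 -> 0 <= sqrt t <= 1).
  { intros t Ht; split; [apply sqrt_pos|].
    rewrite <- sqrt_1; apply sqrt_le_1; lra. }
  replace (RInt h 0 (PI / 2)) with (H (PI / 2) - H 0).
  2:{ unfold H; rewrite RInt_point; unfold zero; simpl; ring. }
  apply (is_RInt_gen_unit_antiderivative (fun t => H (asin (sqrt t)))).
  - intros t Ht.
    pose proof (sqrt_lt_R0 t ltac:(lra)) as Hs0.
    assert (Hs1 : sqrt t < 1) by (rewrite <- sqrt_1; apply sqrt_lt_1; lra).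
    assert (Hst : sqrt t * sqrt t = t) by (apply sqrt_sqrt; lra).
    assert (Hc0 : 0 < sqrt (1 - t)) by (apply sqrt_lt_R0; lra).
    assert (Hsin : sin (asin (sqrt t)) = sqrt t) by (apply sin_asin; lra).
    assert (Hcos : cos (asin (sqrt t)) = sqrt (1 - t))
      by (rewrite cos_asin by lra; unfold Rsqr; rewrite Hst; reflexivity).
    assert (0 < asin (sqrt t) < PI / 2).
    { pose proof (asin_bound_lt (sqrt t) ltac:(lra)).
      destruct (asin_nonneg (sqrt t)) as [|E]; [lra|lra|].
      rewrite <- E, sin_0 in Hsin; lra. }
    replace (f t) with
      ((/ (2 * sqrt t)) * (/ sqrt (1 - sqrt t ^ 2)) * h (asin (sqrt t))).
    + rewrite Rmult_assoc.
      apply (is_derive_comp (fun s => H (asin s)) sqrt).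
      * apply (is_derive_comp H asin); [apply HH|apply is_derive_asin; lra].
      * auto_derive; [lra|field; lra].
    + rewrite Heq, Hsin, Hcos by assumption.
      replace (sqrt t ^ 2) with t by (simpl; rewrite Rmult_1_r; auto).
      field; lra.
  - exact Hf.
  - apply (filterlim_comp _ _ _ (fun t => asin (sqrt t)) H _ (locally 0)); [|apply HC].
    assert (Hl : filterlim sqrt (at_right 0) (locally (sqrt 0)))
      by (eapply filterlim_filter_le_1; [apply filter_le_within|apply continuous_sqrt]).
    rewrite sqrt_0 in Hl.
    apply (filterlim_asin_comp (at_right 0) sqrt 0 ltac:(lra)) in Hl.
    + rewrite asin_0 in Hl; exact Hl.
    + generalize at_right_0_lt_1; apply filter_imp, Hs.
  - apply (filterlim_comp _ _ _ (fun t => asin (sqrt t)) H _ (locally (PI / 2))); [|apply HC].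
    assert (Hl : filterlim sqrt (at_left 1) (locally (sqrt 1)))
      by (eapply filterlim_filter_le_1; [apply filter_le_within|apply continuous_sqrt]).
    rewrite sqrt_1 in Hl.
    apply (filterlim_asin_comp (at_left 1) sqrt 1 ltac:(lra)) in Hl.
    + rewrite asin_1 in Hl; exact Hl.
    + generalize at_left_1_gt_0; apply filter_imp, Hs.
Qed.

(** * [Beta] and [scrF] as convergent integrals *)

Lemma Rpower_sub_half (t : R) (s : nat) :
  0 < t -> Rpower t (INR s - 1 / 2) = t ^ s / sqrt t.
Proof.
  intros Ht; unfold Rminus.
  rewrite Rpower_plus, Rpower_Ropp, Rpower_pow by assumption.
  replace (1 / 2) with (/ 2) by field; rewrite Rpower_sqrt by assumption; reflexivity.
Qed.

Lemma sin_cos_quarter_pos (x : R) : 0 < x < PI / 2 -> 0 < sin x /\ 0 < cos x.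
Proof.
  intros Hx; pose proof PI_RGT_0.
  split; [apply sin_gt_0; lra|apply cos_gt_0; lra].
Qed.

(** [Beta] is only the value selected by [RInt_gen]; the substitution proves convergence, and
    uniqueness of the limit then identifies that value. *)
Lemma is_RInt_gen_beta (k : nat) :
  is_RInt_gen (fun t => t ^ k / sqrt t / sqrt (1 - t)) (at_right 0) (at_left 1)
    (Beta (INR k + 1 / 2) (1 / 2)).
Proof.
  assert (H : is_RInt_gen (fun t => t ^ k / sqrt t / sqrt (1 - t)) (at_right 0) (at_left 1)
    (RInt (fun x => 2 * sin x ^ (2 * k)) 0 (PI / 2))).
  { apply is_RInt_gen_sin_sqr.
    - intros t Ht.
      pose proof (sqrt_lt_R0 t ltac:(lra)); pose proof (sqrt_lt_R0 (1 - t) ltac:(lra)).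
      apply (ex_derive_continuous (fun t => t ^ k / sqrt t / sqrt (1 - t))).
      auto_derive; repeat split; try lra; apply Rgt_not_eq; assumption.
    - intros x; apply (ex_derive_continuous (fun x => 2 * sin x ^ (2 * k))).
      auto_derive; trivial.
    - intros x Hx; destruct (sin_cos_quarter_pos x Hx).
      rewrite <- cos_sqr, !sqrt_pow2 by lra; rewrite pow_mult; field; lra. }
  replace (Beta (INR k + 1 / 2) (1 / 2)) with (RInt (fun x => 2 * sin x ^ (2 * k)) 0 (PI / 2));
    [exact H|].
  symmetry; unfold Beta; apply is_RInt_gen_unique.
  revert H; apply is_RInt_gen_unit_ext; intros t Ht.
  replace (INR k + 1 / 2 - 1) with (INR k - 1 / 2) by field.
  (* The exponent [-1/2] is written as a half-integer shift of 0, so that [Rpower_sub_half] treats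
     both factors. *)
  replace (1 / 2 - 1) with (INR 0 - 1 / 2) by (simpl; field).
  rewrite !Rpower_sub_half by lra; simpl (_ ^ 0); unfold Rdiv; ring.
Qed.

Definition asin_sin_sqr (x : R) : R := asin (sin x ^ 2).

Lemma sin_sqr_bounds (x : R) : 0 <= sin x ^ 2 <= 1.
Proof.
  pose proof (pow2_ge_0 (sin x)); pose proof (pow2_ge_0 (cos x)); rewrite cos_sqr in *; lra.
Qed.

Lemma continuous_asin_sin_sqr (x : R) : continuous asin_sin_sqr x.
Proof.
  apply (filterlim_asin_comp (locally x) (fun y => sin y ^ 2)).
  - apply sin_sqr_bounds.
  - apply filter_forall; intros y; apply sin_sqr_bounds.
  - apply (ex_derive_continuous (fun y => sin y ^ 2)); auto_derive; trivial.
Qed.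

Lemma asin_sin_sqr_bounds (x : R) : 0 <= asin_sin_sqr x <= PI / 2.
Proof. split; [apply asin_nonneg, sin_sqr_bounds|apply asin_bound]. Qed.

Lemma sin_asin_sin_sqr (x : R) : sin (asin_sin_sqr x) = sin x ^ 2.
Proof. apply sin_asin; pose proof (sin_sqr_bounds x); lra. Qed.

(** [1 - sin^4 = cos^2 (1 + sin^2)]: this is how the factor [sqrt (1 + t)] of [scrF] arises. *)
Lemma cos_asin_sin_sqr (x : R) :
  0 <= cos x -> cos (asin_sin_sqr x) = cos x * sqrt (1 + sin x ^ 2).
Proof.
  intros Hx; pose proof (sin_sqr_bounds x).
  unfold asin_sin_sqr; rewrite cos_asin by lra.
  rewrite <- (sqrt_pow2 (cos x)) at 1 by assumption.
  rewrite <- sqrt_mult by (try apply pow2_ge_0; lra).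
  rewrite cos_sqr; f_equal; unfold Rsqr; ring.
Qed.

(** The integrand of [scrF s] after [t = sin^2 x], with [cos x sqrt (1 + sin^2 x)] kept as the
    cosine that occurs in [arc_sin3_prim]. *)
Definition scrF_integrand (s : nat) (x : R) : R :=
  2 * sin x ^ (2 * s) * cos (asin_sin_sqr x) * asin_sin_sqr x.

Lemma continuous_scrF_integrand (s : nat) (x : R) : continuous (scrF_integrand s) x.
Proof.
  apply (continuous_mult (fun x => 2 * sin x ^ (2 * s) * cos (asin_sin_sqr x)));
    [|apply continuous_asin_sin_sqr].
  apply (continuous_mult (fun x => 2 * sin x ^ (2 * s))).
  - apply (ex_derive_continuous (fun x => 2 * sin x ^ (2 * s))); auto_derive; trivial.
  - apply continuous_cos_comp, continuous_asin_sin_sqr.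
Qed.

(** The improper form serves the recurrence, the proper form the evaluation of the series. *)
Lemma scrF_integrals (s : nat) :
  is_RInt_gen (fun t => t ^ s / sqrt t * sqrt (1 + t) * asin t) (at_right 0) (at_left 1)
    (scrF s) /\
  is_RInt (scrF_integrand s) 0 (PI / 2) (scrF s).
Proof.
  assert (H : is_RInt_gen (fun t => t ^ s / sqrt t * sqrt (1 + t) * asin t)
    (at_right 0) (at_left 1) (RInt (scrF_integrand s) 0 (PI / 2))).
  { apply is_RInt_gen_sin_sqr.
    - intros t Ht.
      pose proof (sqrt_lt_R0 t ltac:(lra)).
      apply (ex_derive_continuous (fun t => t ^ s / sqrt t * sqrt (1 + t) * asin t)).
      auto_derive; repeat split; try lra.
      exists (/ sqrt (1 - t ^ 2)); apply is_derive_asin; lra.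
    - apply continuous_scrF_integrand.
    - intros x Hx; destruct (sin_cos_quarter_pos x Hx).
      unfold scrF_integrand; rewrite cos_asin_sin_sqr by lra.
      fold (asin_sin_sqr x).
      rewrite sqrt_pow2 by lra; rewrite pow_mult; field; lra. }
  assert (E : scrF s = RInt (scrF_integrand s) 0 (PI / 2)).
  { unfold scrF; apply is_RInt_gen_unique.
    revert H; apply is_RInt_gen_unit_ext; intros t Ht.
    rewrite Rpower_sub_half by lra; reflexivity. }
  rewrite E; split; [exact H|].
  apply (RInt_correct (V := R_CompleteNormedModule)), ex_RInt_continuous.
  intros; apply continuous_scrF_integrand.
Qed.

(** * Recurrence and closed form for [scrF] *)

Ltac in_R :=
  match goal with |- @eq _ ?a ?b => change (@eq R a b) end;
  repeat match goal with
  | |- context [@plus ?G ?a ?b] => change (@plus G a b) with (Rplus a b)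
  | |- context [@scal ?K ?V ?a ?b] => change (@scal K V a b) with (Rmult a b)
  end.

Lemma is_derive_sqrt_pow (s : nat) (t : R) :
  0 < t -> is_derive (fun u => sqrt u * u ^ s) t ((INR s + 1 / 2) * (t ^ s / sqrt t)).
Proof.
  intros Ht; pose proof (sqrt_lt_R0 t Ht) as Ha.
  (* At [s = 0] the truncated predecessor is harmless, since the factor [INR s] vanishes. *)
  assert (Hp : INR s * t ^ Nat.pred s = INR s * t ^ s / t)
    by (destruct s; [simpl; field|cbn [Nat.pred pow]; field]; lra).
  auto_derive; [lra|].
  rewrite !Rmult_1_l, Hp.
  assert (Hs : t = sqrt t * sqrt t) by (symmetry; apply sqrt_sqrt; lra).
  set (p := t ^ s) in *; set (a := sqrt t) in *; clearbody p a; subst t.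
  field; lra.
Qed.

Lemma is_derive_sqrt_cube (t : R) :
  0 < t -> is_derive (fun u => (1 + u) * sqrt (1 + u)) t (3 / 2 * sqrt (1 + t)).
Proof.
  intros Ht; pose proof (sqrt_lt_R0 (1 + t) ltac:(lra)) as Hb.
  auto_derive; [lra|].
  assert (Hs : sqrt (1 + t) * sqrt (1 + t) = 1 + t) by (apply sqrt_sqrt; lra).
  set (b := sqrt (1 + t)) in *; clearbody b; rewrite <- Hs.
  field; lra.
Qed.

Definition scrF_boundary (s : nat) (t : R) : R :=
  sqrt t * t ^ s * ((1 + t) * sqrt (1 + t)) * asin t.

(** The power factors contribute [t^(s-1/2) sqrt (1+t) ((s+2) t + s + 1/2) asin t]. The derivative
    of [asin] contributes [t^(s+1/2) (1+t) / sqrt (1-t)], a sum of two Beta integrands. *)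
Definition scrF_boundary_deriv (s : nat) (t : R) : R :=
  (INR s + 2) * (t ^ S s / sqrt t * sqrt (1 + t) * asin t)
  + (INR s + 1 / 2) * (t ^ s / sqrt t * sqrt (1 + t) * asin t)
  + (t ^ S s / sqrt t / sqrt (1 - t) + t ^ S (S s) / sqrt t / sqrt (1 - t)).

Lemma is_derive_scrF_boundary (s : nat) (t : R) :
  0 < t < 1 -> is_derive (scrF_boundary s) t (scrF_boundary_deriv s t).
Proof.
  intros Ht.
  pose proof (is_derive_mult _ _ t _ _
    (is_derive_mult _ _ t _ _ (is_derive_sqrt_pow s t ltac:(lra))
      (is_derive_sqrt_cube t ltac:(lra)) Rmult_comm)
    (is_derive_asin t ltac:(lra)) Rmult_comm) as H.
  unfold mult, plus in H; simpl in H.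
  match type of H with is_derive _ _ ?d =>
    replace (scrF_boundary_deriv s t) with d; [exact H|] end.
  unfold scrF_boundary_deriv.
  replace (1 - t * (t * 1)) with ((1 + t) * (1 - t)) by ring.
  rewrite sqrt_mult by lra; cbn [pow].
  pose proof (sqrt_lt_R0 t ltac:(lra)); pose proof (sqrt_lt_R0 (1 + t) ltac:(lra)).
  pose proof (sqrt_lt_R0 (1 - t) ltac:(lra)).
  assert (Hs : t = sqrt t * sqrt t) by (symmetry; apply sqrt_sqrt; lra).
  set (p := t ^ s); set (A := asin t); set (b := sqrt (1 + t)) in *; set (c := sqrt (1 - t)) in *.
  set (a := sqrt t) in *; clearbody p A b c a; subst t.
  field; lra.
Qed.

Lemma continuous_scrF_boundary_deriv (s : nat) (t : R) :
  0 < t < 1 -> continuous (scrF_boundary_deriv s) t.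
Proof.
  intros Ht.
  pose proof (sqrt_lt_R0 t ltac:(lra)); pose proof (sqrt_lt_R0 (1 - t) ltac:(lra)).
  assert (ex_derive (fun x : R => asin x) t)
    by (exists (/ sqrt (1 - t ^ 2)); apply is_derive_asin; lra).
  apply (ex_derive_continuous (scrF_boundary_deriv s)); unfold scrF_boundary_deriv.
  auto_derive; repeat split; try assumption; try lra; apply Rgt_not_eq; assumption.
Qed.

Lemma filterlim_scrF_boundary (s : nat) (F : (R -> Prop) -> Prop) (FF : Filter F) (l : R) :
  0 <= l <= 1 -> F (fun t => 0 < t < 1) -> filter_le F (locally l) ->
  filterlim (scrF_boundary s) F (locally (scrF_boundary s l)).
Proof.
  intros Hl HF Hle.
  apply (filterlim_comp_2 (fun t => sqrt t * t ^ s * ((1 + t) * sqrt (1 + t))) asin Rmult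
    (G := locally (sqrt l * l ^ s * ((1 + l) * sqrt (1 + l)))) (H := locally (asin l))).
  - apply (filterlim_filter_le_1 _ Hle).
    apply (continuous_mult (fun t => sqrt t * t ^ s) (fun t => (1 + t) * sqrt (1 + t))).
    + apply (continuous_mult sqrt (fun t => t ^ s)); [apply continuous_sqrt|].
      apply (ex_derive_continuous (fun t => t ^ s)); auto_derive; trivial.
    + apply (ex_derive_continuous (fun t => (1 + t) * sqrt (1 + t))); auto_derive; lra.
  - apply (filterlim_asin_comp F (fun t => t)); [assumption| |exact Hle].
    revert HF; apply filter_imp; intros t Ht; lra.
  - apply (filterlim_mult (K := R_AbsRing)).
Qed.

Lemma scrF_recurrence (s : nat) :
  (INR s + 2) * scrF (S s) + (INR s + 1 / 2) * scrF s = omega (S s) / 2.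
Proof.
  assert (H : is_RInt_gen (scrF_boundary_deriv s) (at_right 0) (at_left 1)
    (scrF_boundary s 1 - scrF_boundary s 0)).
  { apply (is_RInt_gen_unit_antiderivative (scrF_boundary s)).
    - apply is_derive_scrF_boundary.
    - apply continuous_scrF_boundary_deriv.
    - apply filterlim_scrF_boundary; [apply at_right_proper_filter|lra|apply at_right_0_lt_1|].
      apply filter_le_within.
    - apply filterlim_scrF_boundary; [apply at_left_proper_filter|lra|apply at_left_1_gt_0|].
      apply filter_le_within. }
  pose proof (is_RInt_gen_plus _ _ _ _
    (is_RInt_gen_plus _ _ _ _
      (is_RInt_gen_scal _ (INR s + 2) _ (proj1 (scrF_integrals (S s))))
      (is_RInt_gen_scal _ (INR s + 1 / 2) _ (proj1 (scrF_integrals s))))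
    (is_RInt_gen_plus _ _ _ _ (is_RInt_gen_beta (S s)) (is_RInt_gen_beta (S (S s))))) as H'.
  (* The same integral is evaluated termwise and by the boundary values, which are 0 at 0 and
     [sqrt 2 PI] at 1. *)
  assert (E := eq_trans (eq_sym (is_RInt_gen_unique _ _ H')) (is_RInt_gen_unique _ _ H)).
  change ((INR s + 2) * scrF (S s) + (INR s + 1 / 2) * scrF s +
    (Beta (INR (S s) + 1 / 2) (1 / 2) + Beta (INR (S (S s)) + 1 / 2) (1 / 2))
    = scrF_boundary s 1 - scrF_boundary s 0) in E.
  unfold scrF_boundary in E.
  rewrite asin_0, asin_1, sqrt_1, pow1, Rmult_0_r in E.
  replace (1 + 1) with 2 in E by ring.
  unfold omega.
  replace (INR (S s) + 3 / 2) with (INR (S (S s)) + 1 / 2) by (rewrite !S_INR; field).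
  lra.
Qed.

Lemma central_binomial_wallis (n : nat) : Binomial.C (2 * n) n = 4 ^ n * wallis n.
Proof. unfold wallis; field; apply pow_nonzero; lra. Qed.

(** Variation of constants: the prefactor [a_s = (-1)^s W s / (s+1)] solves the homogeneous
    recurrence [(s+2) a_(s+1) = - (s+1/2) a_s], and the [k]-th summand, with its factor [1/2], is
    [omega k / (2 (k+1) a_k)]. *)
Lemma scrF_closed_form (s : nat) :
  scrF s = (-1) ^ s / 4 ^ s * (Binomial.C (2*s) s / (INR s + 1)) *
    (scrF 0 + 1/2 * sum_n_m (fun k : nat =>
       (-1) ^ k * 4 ^ k / Binomial.C (2*k) k * omega k) 1 s).
Proof.
  induction s as [|s IH].
  - rewrite sum_n_m_zero by lia; unfold zero; simpl (2 * 0)%nat; unfold Binomial.C; simpl.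
    field.
  - rewrite sum_n_Sm by lia; change (@plus R_AbelianMonoid) with Rplus.
    set (T := sum_n_m _ 1 s) in *.
    pose proof (scrF_recurrence s) as Hr; pose proof (pos_INR s).
    apply Rmult_eq_reg_l with (INR s + 2); [|lra].
    replace ((INR s + 2) * scrF (S s)) with (omega (S s) / 2 - (INR s + 1 / 2) * scrF s) by lra.
    rewrite IH, !central_binomial_wallis, !S_INR, wallis_S; cbn [pow].
    pose proof (wallis_pos s).
    assert (4 ^ s <> 0) by (apply pow_nonzero; lra).
    (* The sign of the new summand must cancel against that of the prefactor; fixing the parity of
       [s] lets [field] see this. *)
    assert (He : (-1) ^ s = 1 \/ (-1) ^ s = -1)
      by (clear; induction s as [|s [IH|IH]]; cbn [pow];
          [left|rewrite IH; right|rewrite IH; left]; ring).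
    destruct He as [-> | ->]; field; repeat split; try assumption; lra.
Qed.

(** * Termwise integration and convergence of the series *)

(** Wallis' integral: [W n] times [arc_rem n] is an antiderivative, and every correction in
    [arc_rem] vanishes at [PI / 2] because of its cosine. *)
Lemma is_RInt_sin_pow (n : nat) :
  is_RInt (fun x => sin x ^ (2 * n)) 0 (PI / 2) (PI / 2 * wallis n).
Proof.
  assert (Ha : arc_rem n (PI / 2) = PI / 2).
  { induction n as [|m IH]; [reflexivity|]; cbn [arc_rem].
    rewrite IH, cos_PI2; unfold Rdiv; ring. }
  pose proof (wallis_pos n).
  replace (PI / 2 * wallis n) with (wallis n * (arc_rem n (PI / 2) - arc_rem n 0))
    by (rewrite Ha, arc_rem_0; ring).
  apply (is_RInt_ext (fun x => scal (wallis n) (sin x ^ (2 * n) / wallis n))).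
  { intros x _; in_R; field; lra. }
  apply (is_RInt_scal (V := R_NormedModule)).
  apply (is_RInt_derive (arc_rem n)).
  - intros x _; apply is_derive_arc_rem.
  - intros x _; apply (ex_derive_continuous (fun x => sin x ^ (2 * n) / wallis n)).
    auto_derive; trivial.
Qed.

Lemma term_wallis (r n : nat) : (1 <= n)%nat ->
  term r n = 4 ^ r * term_coef n * wallis (2 * n + r).
Proof.
  intros Hn; unfold term, term_coef.
  replace (4 * n + 2 * r)%nat with (2 * (2 * n + r))%nat by lia.
  rewrite !central_binomial_wallis.
  replace (2 * n + r)%nat with (n + n + r)%nat by lia; rewrite !pow_add.
  pose proof (wallis_pos n); assert (0 < INR n) by (apply lt_0_INR; lia).
  assert (4 ^ n <> 0) by (apply pow_nonzero; lra).
  field; repeat split; try assumption; lra.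
Qed.

(** With [n = m + 1], the powers combine to [sin^(2 (2n + q + 3))], whose Wallis factor is the one
    in [term r n] for [r = q + 3]. *)
Lemma is_RInt_term (q m : nat) :
  is_RInt (fun x => sin x ^ (2 * q) * (term_coef (S m) * sin (asin_sin_sqr x) ^ (2 * m + 5) / 4))
    0 (PI / 2) (PI / (8 * 4 ^ (q + 3)) * term (q + 3) (S m)).
Proof.
  rewrite term_wallis by lia.
  set (k := (2 * S m + (q + 3))%nat).
  replace (PI / (8 * 4 ^ (q + 3)) * (4 ^ (q + 3) * term_coef (S m) * wallis k))
    with (term_coef (S m) / 4 * (PI / 2 * wallis k))
    by (field; apply pow_nonzero; lra).
  apply (is_RInt_ext (fun x => scal (term_coef (S m) / 4) (sin x ^ (2 * k)))).
  { intros x _; rewrite sin_asin_sin_sqr, <- pow_mult.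
    replace (2 * k)%nat with (2 * q + 2 * (2 * m + 5))%nat by (unfold k; lia).
    rewrite pow_add; in_R; field. }
  apply (is_RInt_scal (V := R_NormedModule)), is_RInt_sin_pow.
Qed.

Lemma is_RInt_partial_sum (q M : nat) :
  is_RInt (fun x => sin x ^ (2 * q) *
      (arc_sin3_prim (asin_sin_sqr x) - sin3_rem (S M) (asin_sin_sqr x)))
    0 (PI / 2) (PI / (8 * 4 ^ (q + 3)) * sum_n (fun m => term (q + 3) (S m)) M).
Proof.
  induction M as [|M IH].
  (* [sum_n] up to [M] has [M + 1] terms, hence the remainder of index [S M]. *)
  - rewrite sum_O; eapply is_RInt_ext; [|apply (is_RInt_term q 0)].
    intros x _; cbn [sin3_rem]; in_R; ring.
  - rewrite sum_Sn; change (@plus R_AbelianMonoid) with Rplus; rewrite Rmult_plus_distr_l.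
    eapply is_RInt_ext;
      [|apply (is_RInt_plus (V := R_NormedModule) _ _ _ _ _ _ IH (is_RInt_term q (S M)))].
    intros x _; cbn [sin3_rem]; in_R; ring.
Qed.

(** In [arc_sin3_prim] at [sin^2 phi = sin x], the products [x cos x] give the two values of [scrF],
    and the powers [sin x], [sin^3 x] give the Wallis integrals. *)
Definition limit_integral (q : nat) : R :=
  - (2 * scrF q + scrF (q + 2)) / 6 + PI / 3 * wallis (q + 1) + PI / 18 * wallis (q + 3).

Lemma is_RInt_arc_sin3_prim (q : nat) :
  is_RInt (fun x => sin x ^ (2 * q) * arc_sin3_prim (asin_sin_sqr x))
    0 (PI / 2) (limit_integral q).
Proof.
  pose proof (is_RInt_plus (V := R_NormedModule) _ _ _ _ _ _
    (is_RInt_plus (V := R_NormedModule) _ _ _ _ _ _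
      (is_RInt_scal (V := R_NormedModule) _ _ _ (- / 3) _ (proj2 (scrF_integrals q)))
      (is_RInt_scal (V := R_NormedModule) _ _ _ (- / 6) _ (proj2 (scrF_integrals (q + 2)))))
    (is_RInt_plus (V := R_NormedModule) _ _ _ _ _ _
      (is_RInt_scal (V := R_NormedModule) _ _ _ (2 / 3) _ (is_RInt_sin_pow (q + 1)))
      (is_RInt_scal (V := R_NormedModule) _ _ _ (1 / 9) _ (is_RInt_sin_pow (q + 3))))) as H.
  match type of H with is_RInt _ _ _ ?l => replace (limit_integral q) with l end.
  - revert H; apply is_RInt_ext; intros x _.
    in_R.
    unfold scrF_integrand, arc_sin3_prim; rewrite sin_asin_sin_sqr.
    rewrite !Nat.mul_add_distr_l, !pow_add.
    simpl (2 * 1)%nat; simpl (2 * 2)%nat; simpl (2 * 3)%nat.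
    field.
  - in_R.
    unfold limit_integral; field.
Qed.

(** The difference is the integral of [sin^(2q)] times the remainder [Q_(M+1)], bounded uniformly on
    an interval of length [PI / 2]. *)
Lemma partial_sum_error (q M : nat) :
  Rabs (limit_integral q - PI / (8 * 4 ^ (q + 3)) * sum_n (fun m => term (q + 3) (S m)) M)
    <= PI / 2 * / sqrt (INR (S M)).
Proof.
  pose proof (is_RInt_minus (V := R_NormedModule) _ _ _ _ _ _
    (is_RInt_arc_sin3_prim q) (is_RInt_partial_sum q M)) as H.
  pose proof PI_RGT_0.
  rewrite <- (Rminus_0_r (PI / 2)).
  refine (norm_RInt_le_const _ 0 (PI / 2) _ _ _ _ H); [lra|].
  intros x Hx; unfold minus, plus, opp, norm; simpl.
  unfold abs; simpl.
  set (p := sin x ^ (q + (q + 0))).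
  replace (p * arc_sin3_prim (asin_sin_sqr x) + - (p * (arc_sin3_prim (asin_sin_sqr x) -
    (sin3_rem M (asin_sin_sqr x) - term_coef (S M) * sin (asin_sin_sqr x) ^ (M + (M + 0) + 5) / 4))))
    with (p * sin3_rem (S M) (asin_sin_sqr x)) by (simpl; ring).
  assert (Hp : 0 <= p <= 1).
  { unfold p; pose proof (sin_nonneg_quarter x Hx); split; [apply pow_le; assumption|].
    rewrite <- (pow1 (q + (q + 0))); apply pow_incr; split; [assumption|apply SIN_bound]. }
  pose proof (sin3_rem_nonneg (S M) _ (asin_sin_sqr_bounds x)) as H1.
  pose proof (sin3_rem_upper (S M) _ (asin_sin_sqr_bounds x)) as H2.
  pose proof (wallis_tail_bound M) as H3.
  set (g := sin3_rem (S M) (asin_sin_sqr x)) in *.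
  change (match M with 0%nat => 1 | S _ => INR M + 1 end) with (INR (S M)).
  rewrite Rabs_pos_eq by (apply Rmult_le_pos; lra).
  apply Rle_trans with g; [nra|].
  apply Rle_trans with (1 := H2); exact H3.
Qed.

Lemma is_lim_seq_inv_sqrt : is_lim_seq (fun n => / sqrt (INR (S n))) 0.
Proof.
  apply (is_lim_seq_incr_1 (fun n => / sqrt (INR n))).
  replace (Finite 0) with (Rbar_inv p_infty) by reflexivity.
  apply is_lim_seq_inv; [|discriminate].
  apply (filterlim_comp _ _ _ INR sqrt _ (Rbar_locally p_infty));
    [apply is_lim_seq_INR|apply filterlim_sqrt_p].
Qed.

Lemma is_series_term (q : nat) :
  is_series (fun m => term (q + 3) (S m)) (8 * 4 ^ (q + 3) / PI * limit_integral q).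
Proof.
  pose proof PI_RGT_0.
  assert (H4 : 4 ^ (q + 3) <> 0) by (apply pow_nonzero; lra).
  pose (c := PI / (8 * 4 ^ (q + 3))).
  assert (L : is_lim_seq
    (fun M => limit_integral q - c * sum_n (fun m => term (q + 3) (S m)) M) 0).
  { apply is_lim_seq_abs_0.
    apply (is_lim_seq_le_le (fun _ => 0) _ (fun M => PI / 2 * / sqrt (INR (S M)))).
    - intros M; split; [apply Rabs_pos|apply partial_sum_error].
    - apply is_lim_seq_const.
    - replace (Finite 0) with (Rbar_mult (PI / 2) 0) by (simpl; f_equal; ring).
      apply is_lim_seq_scal_l, is_lim_seq_inv_sqrt. }
  assert (L' : is_lim_seq (sum_n (fun m => term (q + 3) (S m)))
    (8 * 4 ^ (q + 3) / PI * (limit_integral q - 0))); [|rewrite Rminus_0_r in L'; exact L'].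
  (* The partial sum is recovered from its error term; the factor in front is [1 / c]. *)
  apply (is_lim_seq_ext (fun M => 8 * 4 ^ (q + 3) / PI *
    (limit_integral q - (limit_integral q - c * sum_n (fun m => term (q + 3) (S m)) M)))).
  { intros M; unfold c; field; lra. }
  apply (is_lim_seq_scal_l _ _ (limit_integral q - 0)).
  apply is_lim_seq_minus'; [apply is_lim_seq_const|exact L].
Qed.

Theorem theorem6p0p1 :
  (forall r : nat, (3 <= r)%nat ->
     is_series (fun m : nat => term r (S m))
       (4/9 * Binomial.C (2*r) r + 128/3 * Binomial.C (2*r - 4) (r - 2)
        - 4 ^ (r+1) / (3 * PI) * scrF (r - 1)
        - 2 * 4 ^ (r+1) / (3 * PI) * scrF (r - 3)))
  /\
  (forall s : nat,
     scrF s = (-1) ^ s / 4 ^ s * (Binomial.C (2*s) s / (INR s + 1)) *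
       (scrF 0 + 1/2 * sum_n_m (fun k : nat =>
           (-1) ^ k * 4 ^ k / Binomial.C (2*k) k * omega k) 1 s)).
Proof.
  split; [|exact scrF_closed_form].
  intros r Hr; pose proof PI_RGT_0.
  (* Writing [r = q + 3] removes all truncated subtractions. *)
  pose (q := (r - 3)%nat).
  replace r with (q + 3)%nat by (unfold q; lia); clearbody q.
  replace (2 * (q + 3) - 4)%nat with (2 * (q + 1))%nat by lia.
  replace (q + 3 - 2)%nat with (q + 1)%nat by lia.
  replace (q + 3 - 1)%nat with (q + 2)%nat by lia.
  replace (q + 3 - 3)%nat with q by lia.
  rewrite !central_binomial_wallis.
  match goal with |- is_series _ ?l =>
    replace l with (8 * 4 ^ (q + 3) / PI * limit_integral q); [apply is_series_term|] end.
  unfold limit_integral; rewrite !pow_add; field; lra.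
Qed.
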